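(* Let $\Gamma$ be a finite tree with at least two vertices and let $D=\mathrm{diam}(\Gamma)$. If $g\in A(\Gamma)$, then $$\sum_{x\in V(\Gamma^e)}d_{\mathrm{Lk}(x)}(\pi_x(v),\pi_x(v^g))\asymp_{4D,4D}\|g\|_{\mathrm{syl}}$$ for some $v\in V(\Gamma)$.
   Context: $A(\Gamma)=\langle V(\Gamma)\mid [a,b]=1 \text{ for each } \{a,b\}\in E(\Gamma)\rangle$. The extension graph $\Gamma^e$ has vertex set $\{v^g : v\in V(\Gamma), g\in A(\Gamma)\}$, $v^g=g^{-1}vg$, with two distinct vertices adjacent iff they commute; it carries the graph metric, and when $\Gamma$ is a tree, $\Gamma^e$ is also a tree. $\mathrm{Lk}(x)=\mathrm{Lk}_{\Gamma^e}(x)$ is the set of vertices of $\Gamma^e$ adjacent to $x$. The syllable length $\|g\|_{\mathrm{syl}}$ is the minimum $\ell$ such that $g$ is a product of $\ell$ elements of $\bigcup_{v\in V(\Gamma)}\langle v\rangle$ (with $\|1\|_{\mathrm{syl}}=0$). The notation $A\asymp_{K,C}B$ means $\frac1K B-C\le A\le KB+C$. Vertex link projection: for vertices $x,y$ of $\Gamma^e$, $\pi_x(y)=\delta\cap\mathrm{Lk}(x)$ where $\delta$ is the unique geodesic in $\Gamma^e$ from $x$ to $y$ (so $\pi_x(y)$ is a single vertex if $y\ne x$ and is empty if $y=x$); terms of the sum in which a projection is empty are counted as $0$. Metric on links: for $u\in V(\Gamma)$, $L=\mathrm{Lk}_\Gamma(u)$ is discrete, so $F=\langle L\rangle\le A(\Gamma)$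 is free on $L$. One has $\mathrm{Lk}_{\Gamma^e}(u)=\{w^h : w\in L, h\in F\}$, identified with the extension graph $L^e$ of the discrete graph $L$, which is the graph on this vertex set in which two distinct vertices $w_1^{h_1}, w_2^{h_2}$ are adjacent iff there is $h\in F$ with $w_1^{h_1}=w_1^{h}$ and $w_2^{h_2}=w_2^{h}$; $d_{\mathrm{Lk}(u)}$ is its graph metric. For $x=u^h$, $\mathrm{Lk}(x)=\mathrm{Lk}(u)^h$ carries the metric transported by conjugation by $h$. *)

(* Defs.v *)
From HB Require Import structures.
From mathcomp Require Import all_boot all_order all_algebra.
From mathcomp Require Import all_classical all_reals all_analysis.

Set Implicit Arguments.
Unset Strict Implicit.
Unset Printing Implicit Defensive.

Import Order.TTheory GRing.Theory Num.Theory.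

Local Open Scope classical_set_scope.
Local Open Scope group_scope.

Section Graphs.
Variables (T : choiceType) (adj : rel T).

Definition walk (x y : T) : set (seq T) :=
  [set p | path adj x p /\ last x p = y].

Definition geodesic (x y : T) : set (seq T) :=
  [set p | walk x y p /\ forall q, walk x y q -> (size p <= size q)%N].

(* +oo when x and y lie in different components. *)
Definition gdist (R : realType) (x y : T) : \bar R :=
  ereal_inf [set ((size p)%:R%R : R)%:E | p in walk x y].

End Graphs.

Definition is_tree (V : finType) (e : rel V) : Prop :=
  [/\ symmetric e, irreflexive e, (forall x y, connect e x y)
    & forall c : seq V, (2 < size c)%N -> ~~ ucycleb e c].

Definition diam (R : realType) (V : finType) (e : rel V) : R :=
  fine (ereal_sup [set gdist e R xy.1 xy.2 | xy in [set: V * V]]).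

Section RightAngledArtinGroup.
Variables (V : finType) (e : rel V).

(* The letter (v, true) stands for v and (v, false) for its inverse. *)
Definition word := seq (V * bool).

Inductive raag_rel : word -> word -> Prop :=
| raag_refl s : raag_rel s s
| raag_sym s t : raag_rel s t -> raag_rel t s
| raag_trans s t u : raag_rel s t -> raag_rel t u -> raag_rel s u
| raag_cancel s t v b : raag_rel (s ++ [:: (v, b); (v, ~~ b)] ++ t) (s ++ t)
| raag_comm s t a b : e a b ->
    raag_rel (s ++ [:: (a, false); (b, false); (a, true); (b, true)] ++ t)
             (s ++ t).

Definition raag_relb : rel word := fun s t => `[< raag_rel s t >].

Lemma raag_relb_refl : reflexive raag_relb.
Proof. by move=> s; apply/asboolP; exact: raag_refl. Qed.

Lemma raag_relb_sym : symmetric raag_relb.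
Proof. by move=> s t; apply/asboolP/asboolP; exact: raag_sym. Qed.

Lemma raag_relb_trans : transitive raag_relb.
Proof.
by move=> s t u /asboolP ts /asboolP su; apply/asboolP; exact: raag_trans su.
Qed.

Canonical raag_equiv :=
  EquivRel raag_relb raag_relb_refl raag_relb_sym raag_relb_trans.

Definition raag := {eq_quot raag_equiv}%qT.

HB.instance Definition _ : EqQuotient _ raag_equiv raag := EqQuotient.on raag.
HB.instance Definition _ := Choice.on raag.

Local Open Scope quotient_scope.

Lemma raag_piP (s t : word) : \pi_raag s = \pi_raag t <-> raag_rel s t.
Proof. by split=> [/eqmodP/asboolP //|st]; apply/eqmodP/asboolP. Qed.

Definition winv (s : word) : word := rev [seq (a.1, ~~ a.2) | a <- s].

Lemma winvK : involutive winv.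
Proof.
move=> s; rewrite /winv map_rev revK -map_comp -[RHS]map_id.
by apply: eq_map => -[v b] /=; rewrite negbK.
Qed.

Lemma winv_cat s t : winv (s ++ t) = winv t ++ winv s.
Proof. by rewrite /winv map_cat rev_cat. Qed.

Lemma raag_cat2 s t u w : raag_rel s t -> raag_rel (u ++ s ++ w) (u ++ t ++ w).
Proof.
elim=> {s t} [s|s t _ |s t r _ ? _|s t v b|s t a b ab].
- exact: raag_refl.
- exact: raag_sym.
- exact: raag_trans.
- by rewrite -!catA catA [X in raag_rel _ X]catA; exact: raag_cancel.
- by rewrite -!catA catA [X in raag_rel _ X]catA; exact: raag_comm.
Qed.

Lemma raag_cat s t s' t' :
  raag_rel s t -> raag_rel s' t' -> raag_rel (s ++ s') (t ++ t').
Proof.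
move=> st st'; apply: (@raag_trans _ (t ++ s')).
  exact: (raag_cat2 [::] s' st).
by have := raag_cat2 t [::] st'; rewrite !cats0.
Qed.

Lemma raag_catVw s : raag_rel (winv s ++ s) [::].
Proof.
elim: s => [|[v b] s IH]; first exact: raag_refl.
rewrite -[(v, b) :: s]/([:: (v, b)] ++ s) winv_cat.
rewrite -catA.
apply: raag_trans IH.
by have := raag_cancel (winv s) s v (~~ b); rewrite negbK.
Qed.

Lemma raag_catwV s : raag_rel (s ++ winv s) [::].
Proof. by have := raag_catVw (winv s); rewrite winvK. Qed.

Lemma raag_winv s t : raag_rel s t -> raag_rel (winv s) (winv t).
Proof.
move=> st; apply: (@raag_trans _ (winv s ++ t ++ winv t)).
  apply: raag_sym; rewrite -[X in raag_rel _ X]cats0.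
  by apply: raag_cat; [exact: raag_refl|exact: raag_catwV].
apply: (@raag_trans _ (winv s ++ s ++ winv t)).
  exact/raag_cat2/raag_sym.
by rewrite catA; exact: (raag_cat (raag_catVw s) (raag_refl _)).
Qed.

Definition raag_one : raag := \pi_raag [::].
Definition raag_inv (x : raag) : raag := \pi_raag (winv (repr x)).
Definition raag_mul (x y : raag) : raag := \pi_raag (repr x ++ repr y).

Lemma raag_repr s : raag_rel (repr (\pi_raag s)) s.
Proof. by apply/raag_piP; rewrite reprK. Qed.

Lemma raag_mul_pi s t : raag_mul (\pi_raag s) (\pi_raag t) = \pi_raag (s ++ t).
Proof. by apply/raag_piP/raag_cat; exact: raag_repr. Qed.

Lemma raag_inv_pi s : raag_inv (\pi_raag s) = \pi_raag (winv s).
Proof. exact/raag_piP/raag_winv/raag_repr. Qed.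

Lemma raag_mulA : associative raag_mul.
Proof.
move=> x y z; elim/quotW: x => s; elim/quotW: y => t; elim/quotW: z => u.
by rewrite (raag_mul_pi t u) (raag_mul_pi s t) (raag_mul_pi s (t ++ u))
           (raag_mul_pi (s ++ t) u) catA.
Qed.

Lemma raag_mul1 : left_id raag_one raag_mul.
Proof. by move=> x; rewrite -[x]reprK raag_mul_pi. Qed.

Lemma raag_mulr1 : right_id raag_one raag_mul.
Proof. by move=> x; rewrite -[x]reprK raag_mul_pi cats0. Qed.

Lemma raag_mulV : left_inverse raag_one raag_inv raag_mul.
Proof.
move=> x; rewrite -[x]reprK raag_inv_pi raag_mul_pi.
by rewrite /raag_one; apply/raag_piP; exact: raag_catVw.
Qed.

Lemma raag_mulVr : right_inverse raag_one raag_inv raag_mul.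
Proof.
move=> x; rewrite -[x]reprK raag_inv_pi raag_mul_pi.
by rewrite /raag_one; apply/raag_piP; exact: raag_catwV.
Qed.

HB.instance Definition _ := isGroup.Build raag
  raag_mulA raag_mul1 raag_mulr1 raag_mulV raag_mulVr.

Definition raag_gen (v : V) : raag := \pi_raag [:: (v, true)].

End RightAngledArtinGroup.

Section Subgroups.
Variable G : groupType.

Definition is_subgroup (H : set G) : Prop :=
  [/\ H 1, (forall x y, H x -> H y -> H (x * y)) & forall x, H x -> H x^-1].

Definition generated (S : set G) : set G := smallest is_subgroup S.

End Subgroups.

Section ExtensionGraph.
Variables (V : finType) (e : rel V).
Local Notation A := (raag e).

Definition syllable (a : A) : Prop :=
  exists v : V, generated [set raag_gen e v] a.

Definition syllable_prod (g : A) (l : nat) : Prop :=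
  exists s : seq A, [/\ size s = l, (forall a, a \in s -> syllable a)
                      & g = \prod_(a <- s) a].

Lemma syllable_prod_ex (g : A) : exists l, `[< syllable_prod g l >].
Proof.
suff [s [ss gE]] : exists s : seq A,
    (forall a, a \in s -> syllable a) /\ g = \prod_(a <- s) a.
  by exists (size s); apply/asboolP; exists s.
rewrite -[g]reprK; elim: (repr g) => [|[v b] w [s [ss sE]]].
  by exists [::]; rewrite big_nil.
exists ((\pi_(raag e) [:: (v, b)])%qT :: s); split; last first.
  by rewrite big_cons -sE [RHS]raag_mul_pi.
move=> a; rewrite inE => /predU1P[->|/ss//]; exists v => H [[_ _ HV] Hv].
have {}Hv : H (raag_gen e v) by exact: Hv.
case: b => //; move/HV: Hv; congr H; exact: raag_inv_pi.
Qed.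

Definition syl (g : A) : nat := ex_minn (syllable_prod_ex g).

Definition ext_vertex : set A :=
  [set x | exists (v : V) (g : A), x = raag_gen e v ^ g].

Definition ext_adj : rel A := fun x y =>
  `[< [/\ ext_vertex x, ext_vertex y, x <> y & commute x y] >].

Definition ext_link (x : A) : set A := [set y | ext_adj x y].

Definition link_proj (x y : A) : set A :=
  [set z | ext_link x z /\
     exists2 p, geodesic ext_adj x y p & z \in x :: p].

Definition link_subgroup (u : V) : set A :=
  generated [set raag_gen e w | w in [set w | e u w]].

(* The extension graph of the discrete graph Lk_Gamma(u): adjacency is by a
   common conjugator in the free group <Lk_Gamma(u)>, not by commutation. *)
Definition base_link_adj (u : V) : rel A := fun y z =>
  `[< y <> z /\ exists w1 w2 h, [/\ e u w1, e u w2, link_subgroup u h,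
        y = raag_gen e w1 ^ h & z = raag_gen e w2 ^ h] >].

(* A representation x = u^h is chosen; the metric does not depend on the
   choice, since u is determined by x, and h up to left multiplication by the
   centralizer of u, which acts on Lk(u) by isometries. *)
Definition link_dist (R : realType) (x y z : A) : \bar R :=
  if pselect (exists uh : V * A, x = raag_gen e uh.1 ^ uh.2) is left xP then
    let: (u, h) := sval (cid xP) in
    gdist (base_link_adj u) R (y ^ h^-1) (z ^ h^-1)
  else 0%E.

(* Used with P and Q empty or singletons; 0 if one of them is empty. *)
Definition link_dist_set (R : realType) (x : A) (P Q : set A) : \bar R :=
  if `[< P !=set0 /\ Q !=set0 >] then link_dist R x (xget 1 P) (xget 1 Q)
  else 0%E.

End ExtensionGraph.

Arguments ext_vertex {V} e _.

Definition asymp (R : realType) (K C : R) (A B : \bar R) : Prop :=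
  ((K^-1)%R%:E * B - C%:E <= A)%E /\ (A <= K%:E * B + C%:E)%E.

(* Main.v *)
Require Import Defs.
From mathcomp Require Import all_boot all_order all_algebra.
From mathcomp Require Import all_classical all_reals all_analysis.
From mathcomp Require Import ring lra zify.

(** Take for [v] a leaf of the tree. The extension graph is a tree, so the terms
    of the sum come from the interior vertices [x] of the geodesic from [v] to
    [v ^ g], and the two projections to the link of [x] are the neighbours of
    [x] on the geodesic.

    Lower bound ([syl_le_esum]). Consecutive edges of the geodesic are conjugates
    of edges of the defining tree, and at an interior vertex [x = u ^ h] the
    conjugator changes by an element of the centralizer of [u]. Up to a power of
    [u], this is an element of the free group on the link of [u], and a walk
    of length [m] between the two neighbours writes it as a product of [m + 1]
    syllables ([link_dist_syllables]). With the power of [u] this makes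
    [m + 2 <= 3 m] syllables, hence at most three times the sum along the whole
    geodesic. Since [v] is a leaf, its centralizer is generated by two commuting
    elements, and the two ends contribute at most four more syllables.

    Upper bound ([gallery_esum_le], [gallery_syllable_prod]). A word of [l]
    syllables for [g] yields a walk from [v ^ g] to [v] of length at most
    [2 D l] in which every turn is conjugate to a turn of the defining tree,
    hence costs at most 1 in the link of the vertex where it occurs. Projections
    to the link of [x] change only when the walk passes through [x], so the sum
    is at most the length of the walk.

    Three facts on the extension graph underlie this: the centralizer of a
    generator [u] is [<Lk u> <u>] ([centralizer_gen]), adjacent vertices are
    simultaneously conjugate to adjacent generators ([ext_adjP]), and every edge
    is a bridge ([ext_bridge]), so that projections are single vertices and are
    constant along walks avoiding the vertex projected to. The first and the
    third come from integer-valued cocycles of the group acting on itself, which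
    can be prescribed on generators ([raag_cocycle]): one counts the occurrences
    of a letter in a word, recorded by cosets of [<Lk u>], and has finite
    support; the other is the cocycle of the Bass-Serre tree obtained by cutting
    the defining tree at an edge, and provides a function on the vertices of the
    extension graph that changes only across this edge. The second follows from
    the first by retracting the group onto the subgroup generated by a star. *)

Set Implicit Arguments.
Unset Strict Implicit.
Unset Printing Implicit Defensive.

Import Order.TTheory GRing.Theory Num.Theory.

Local Open Scope classical_set_scope.
Local Open Scope ring_scope.

(** * Sequences and sums *)

Lemma injective_not_in_seq (T : choiceType) (f : nat -> T) (s : seq T) :
  injective f -> exists n, f n \notin s.
Proof.
move=> finj; apply: contrapT => /forallNP h.
suff : (size s < size s)%N by rewrite ltnn.
have /uniq_leq_size : uniq (map f (iota 0 (size s).+1)).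
  by rewrite map_inj_uniq // iota_uniq.
rewrite size_map size_iota; apply=> x /mapP [n _ ->].
by apply/negPn/negP => /(h n).
Qed.

Lemma sum_count_mem (T : choiceType) (s t : seq T) :
  uniq t -> (\sum_(x <- t) count_mem x s <= size s)%N.
Proof.
move=> ut; elim: s => [|y s IH]; first by rewrite big1.
rewrite /= big_split -add1n leq_add //=; rewrite -big_mkcond sum1_count.
by rewrite (eq_count (a2 := pred1 y)) ?count_uniq_mem ?leq_b1 // => x; exact: eq_sym.
Qed.

Lemma sum_uniq_le_esum (R : realType) (T : choiceType) (S : set T)
    (a : T -> \bar R) (s : seq T) :
  uniq s -> (forall x, x \in s -> S x) ->
  (\sum_(x <- s) a x <= \esum_(x in S) a x)%E.
Proof.
move=> us sS; apply: esum_ge; exists [set` s]; first by split.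
by rewrite -fsbig_seq.
Qed.

(** * Generated subgroups and conjugation *)

Section Generation.
Variable G : groupType.
Local Open Scope group_scope.

Lemma generated_sub (S : set G) : S `<=` generated S.
Proof. by move=> x Sx H [_ SH]; exact: SH. Qed.

Lemma generated_subgroup (S : set G) : is_subgroup (generated S).
Proof.
split=> [H [[]//]|x y Sx Sy H HS|x Sx H HS].
  by case: (HS) => -[_ HM _] _; apply: HM; [exact: Sx|exact: Sy].
by case: (HS) => -[_ _ HV] _; apply: HV; exact: Sx.
Qed.

Lemma generated_min (S H : set G) :
  is_subgroup H -> S `<=` H -> generated S `<=` H.
Proof. by move=> HG SH x; apply; split. Qed.

Lemma generated_commute (S : set G) y x :
  (forall s, S s -> commute y s) -> generated S x -> commute y x.
Proof.
move=> Sy; apply: (generated_min (H := [set x | commute y x])) => //.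
by split=> [|a b|a] /=; [exact: commute1|exact: commuteM|exact: commuteV].
Qed.

Lemma generated_coset (S : set G) x y :
  generated S x -> generated S (y * x^-1) <-> generated S y.
Proof.
have [_ SM SV] := generated_subgroup S.
move=> Sx; split=> Sy; last by apply: SM; last exact: SV.
by rewrite -(mulgVK x y); exact: SM.
Qed.

Lemma generated_expg (S : set G) x n : generated S x -> generated S (x ^+ n).
Proof.
have [S1 SM SV] := generated_subgroup S.
by move=> Sx; elim: n => // n IH; rewrite expgS; exact: SM.
Qed.

Lemma conjg_commute (x g : G) : commute x g -> x ^ g = x.
Proof. by move=> xg; rewrite conjgE xg mulKg. Qed.

Lemma conjg_eq_commute (x g h : G) :
  x ^ g = x ^ h -> commute x (g * h^-1).
Proof.
move=> xgh; have := conjgC x (g * h^-1).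
by rewrite conjgM xgh conjgK.
Qed.

Lemma commute_conjg (x y g : G) :
  commute x y -> commute (x ^ g) (y ^ g).
Proof. by move=> xy; rewrite /commute -!conjMg xy. Qed.

End Generation.

(** * Cocycles and retractions on a right-angled Artin group *)

Section Presentation.
Variables (V : finType) (e : rel V).
Local Notation A := (raag e).
Local Notation gen := (raag_gen e).
Local Open Scope group_scope.
Local Open Scope quotient_scope.

Lemma raag_pi_cat (s t : word V) :
  \pi_(raag e) (s ++ t) = \pi_(raag e) s * \pi_(raag e) t.
Proof. by rewrite -[RHS]/(raag_mul _ _) raag_mul_pi. Qed.

Lemma raag_pi_nil : \pi_(raag e) [::] = 1.
Proof. by []. Qed.

Lemma raag_pi_letter v b :
  \pi_(raag e) [:: (v, b)] = if b then gen v else (gen v)^-1.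
Proof. by case: b => //; rewrite -[RHS]/(raag_inv _) raag_inv_pi. Qed.

Lemma raag_pi_cons v b s :
  \pi_(raag e) ((v, b) :: s) =
  (if b then gen v else (gen v)^-1) * \pi_(raag e) s.
Proof. by rewrite -cat1s raag_pi_cat raag_pi_letter. Qed.

Lemma raag_gen_commute a b : e a b -> commute (gen a) (gen b).
Proof.
move=> ab; have := @raag_comm _ e [::] [::] a b ab => /raag_piP.
rewrite !raag_pi_cons !raag_pi_nil mulg1 => h.
apply: (mulgI (gen b)^-1); apply: (mulgI (gen a)^-1).
by rewrite h mulKg mulVg.
Qed.

Lemma raag_generated (H : set A) :
  is_subgroup H -> (forall v, H (gen v)) -> forall g, H g.
Proof.
move=> [H1 HM HV] Hgen; elim/quotW; elim=> [//|[v b] s IH].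
by rewrite raag_pi_cons; apply: HM => //; case: b => //; exact: HV.
Qed.

Section Cocycle.
Variables (X : Type) (M : zmodType) (act : A -> X -> X).
Hypothesis act1 : forall x, act 1 x = x.
Hypothesis actM : forall g h x, act (g * h) x = act g (act h x).
Variable d : V -> X -> M.
Hypothesis d_comm : forall a b x, e a b ->
  (d a (act (gen b) x) + d b x)%R = (d b (act (gen a) x) + d a x)%R.

Let letter (a : V * bool) (x : X) : M :=
  if a.2 then d a.1 x else (- d a.1 (act (gen a.1)^-1%g x))%R.

Let Fixpoint Dw (s : word V) (x : X) : M :=
  if s is a :: s' then (letter a (act (\pi_(raag e) s') x) + Dw s' x)%R
  else 0%R.

Let Dw_cat s t x : Dw (s ++ t) x = (Dw s (act (\pi_(raag e) t) x) + Dw t x)%R.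
Proof.
elim: s => [|a s IH] /=; first by rewrite add0r.
by rewrite IH addrA raag_pi_cat actM.
Qed.

Let Dw_drop s t u : raag_rel e u [::] -> (forall x, Dw u x = 0%R) ->
  forall x, Dw (s ++ u ++ t) x = Dw (s ++ t) x.
Proof.
move=> /raag_piP ru du x; rewrite !Dw_cat du add0r; congr (Dw s (act _ _) + _)%R.
by rewrite raag_pi_cat ru mul1g.
Qed.

Let Dw_rel s t : raag_rel e s t -> forall x, Dw s x = Dw t x.
Proof.
elim=> {s t} [//|s t _ IH x//|s t u _ IH1 _ IH2 x|s t v b|s t a b ab].
- by rewrite IH1.
- apply: Dw_drop; first exact: raag_cancel [::] [::] v b.
  move=> x /=; rewrite raag_pi_letter raag_pi_nil act1 addr0 /letter /=.
  by case: b; rewrite /= -?actM ?mulgV ?mulVg ?act1 ?addrN ?addNr.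
- apply: Dw_drop; first exact: raag_comm [::] [::] a b ab.
  move=> x /=; rewrite !raag_pi_cons raag_pi_nil !mulg1 act1 addr0 /letter /=.
  have cab := raag_gen_commute ab.
  rewrite -!actM !mulgA.
  have -> : (gen a)^-1 * (gen b)^-1 * gen a * gen b = 1.
    by rewrite -!mulgA [X in _ * (_ * X)]cab mulKg mulVg.
  have -> : (gen b)^-1 * gen a * gen b = gen a by rewrite -mulgA cab mulKg.
  by rewrite d_comm // act1 addKr addNr.
Qed.

(** A cocycle is a homomorphism to a semidirect product in disguise, so it can
    be prescribed on the generators as soon as the values are compatible with
    the commutation relators. It is read off a word letter by letter, the value
    on an inverse letter being forced. *)
Lemma raag_cocycle : exists D : A -> X -> M,
  (forall v x, D (gen v) x = d v x) /\
  (forall g h x, D (g * h) x = (D g (act h x) + D h x)%R).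
Proof.
have Drepr s x : Dw (repr (\pi_(raag e) s)) x = Dw s x.
  exact/Dw_rel/raag_repr.
exists (fun g => Dw (repr g)); split=> [v x|].
  by rewrite /raag_gen Drepr /= raag_pi_nil act1 addr0.
elim/quotW=> s; elim/quotW=> t x.
by rewrite -raag_pi_cat !Drepr Dw_cat.
Qed.

End Cocycle.

Definition exponent_of (u : V) (E : A -> int) : Prop :=
  [/\ forall v, E (gen v) = (v == u)%:R%R,
      forall g h, E (g * h) = (E g + E h)%R,
      E 1 = 0%R & forall g, E g^-1 = (- E g)%R].

(** Cocycles over a one-point set are homomorphisms. *)
Lemma raag_exponent (u : V) : exists E : A -> int, exponent_of u E.
Proof.
have [//|//||D [Dgen DM]] := @raag_cocycle unit int (fun _ x => x) _ _
  (fun v _ => (v == u)%:R%R).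
  by move=> a b _ _; rewrite addrC.
have D1 : D 1 tt = 0%R.
  by have /eqP := DM 1 1 tt; rewrite mulg1 eq_sym -subr_eq0 addrK => /eqP.
exists (D^~ tt); split=> // g.
by have /eqP := DM g g^-1 tt; rewrite mulgV D1 eq_sym addrC addr_eq0 => /eqP.
Qed.

Let keep (P : pred V) (s : word V) : word V := [seq a <- s | P a.1].

Let keep_rel P s t : raag_rel e s t -> raag_rel e (keep P s) (keep P t).
Proof.
elim=> {s t} [s|s t _|s t u _ IH1 _ IH2|s t v b|s t a b ab].
- exact: raag_refl.
- exact: raag_sym.
- exact: raag_trans IH2.
- rewrite /keep !filter_cat /=; case: (P v); last exact: raag_refl.
  exact: (raag_cancel e (keep P s) (keep P t) v b).
- rewrite /keep !filter_cat /=.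
  case: (P a); case: (P b); last exact: raag_refl.
  + exact: (raag_comm (keep P s) (keep P t) ab).
  + exact: (raag_cancel e (keep P s) (keep P t) a false).
  + exact: (raag_cancel e (keep P s) (keep P t) b false).
Qed.

Definition retraction_on (P : pred V) (r : A -> A) : Prop :=
  [/\ forall v, r (gen v) = if P v then gen v else 1,
      forall g h, r (g * h) = r g * r h,
      r 1 = 1 & forall g, r g^-1 = (r g)^-1].

(** Erasing the letters outside [P] turns each relator into a relator or into a
    product that cancels freely. *)
Lemma raag_retraction (P : pred V) : exists r : A -> A, retraction_on P r.
Proof.
have rpi s : \pi_(raag e) (keep P (repr (\pi_(raag e) s))) =
             \pi_(raag e) (keep P s).
  exact/raag_piP/keep_rel/raag_repr.
pose r (g : A) : A := \pi_(raag e) (keep P (repr g)).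
have rM g h : r (g * h) = r g * r h.
  elim/quotW: g => s; elim/quotW: h => t.
  by rewrite -raag_pi_cat /r !rpi /keep filter_cat raag_pi_cat.
have r1 : r 1 = 1 by apply: (mulgI (r 1)); rewrite -rM !mulg1.
exists r; split=> // [v|g].
  by rewrite /r /raag_gen rpi /=; case: ifP.
by apply: (mulgI (r g)); rewrite -rM !mulgV.
Qed.

Lemma retraction_generated P r g :
  retraction_on P r -> generated [set gen v | v in [set v | P v]] (r g).
Proof.
move=> [rgen rM r1 rV].
have [G1 GM GV] := generated_subgroup [set gen v | v in [set v | P v]].
apply: (raag_generated (H := [set g | generated _ (r g)])) => [|v].
  split=> [|x y|x] /=; first by rewrite r1.
    by rewrite rM; exact: GM.
  by rewrite rV; exact: GV.
rewrite /= rgen; case: ifP => // Pv.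
by apply: generated_sub; exists v.
Qed.

Lemma retraction_id (P : pred V) (Q : set V) r g :
  retraction_on P r -> (forall v, Q v -> P v) ->
  generated [set gen v | v in Q] g -> r g = g.
Proof.
move=> [rgen rM r1 rV] QP.
apply: (generated_min (H := [set g | r g = g])) => [|_ [v /= /QP Pv <-]].
  split=> [|x y|x] //=; first by rewrite rM => -> ->.
  by rewrite rV => ->.
by rewrite rgen Pv.
Qed.

Lemma retraction_conj P r x g : retraction_on P r -> r (x ^ g) = r x ^ r g.
Proof. by move=> [_ rM _ rV]; rewrite !conjgE !rM rV. Qed.

End Presentation.

(** * Centralizers of the generators *)

Section Centralizers.
Variables (V : finType) (e : rel V).
Hypotheses (e_sym : symmetric e) (e_irr : irreflexive e).
Local Notation A := (raag e).
Local Notation gen := (raag_gen e).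
Local Notation L u := (@link_subgroup V e u).
Local Open Scope group_scope.

(** The exponent of a generator is invariant under conjugation. *)
Lemma gen_inj u v g h : gen u ^ g = gen v ^ h -> u = v.
Proof.
move=> gh; have [E [Egen EM E1 EV]] := raag_exponent e v.
have := congr1 E gh; rewrite !conjgE !EM !EV !Egen eqxx.
have -> x y : (- x + (y + x) = y :> int)%R by ring.
have -> x y : (- x + (y + x) = y :> int)%R by ring.
by case: eqP.
Qed.

Lemma link_subgroup_subgroup u : is_subgroup (L u).
Proof. exact: generated_subgroup. Qed.

Lemma link_subgroup_commute u f : L u f -> commute (gen u) f.
Proof.
by apply: generated_commute => _ [w /= uw <-]; exact: raag_gen_commute.
Qed.

Lemma cyclic_commute v x y :
  generated [set gen v] x -> commute y (gen v) -> commute y x.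
Proof. by move=> vx yv; apply: generated_commute vx => _ ->. Qed.

Lemma link_subgroup_exponent u E f : exponent_of u E -> L u f -> E f = 0%R.
Proof.
move=> [Egen EM E1 EV].
apply: (generated_min (H := [set f | E f = 0%R])) => [|_ [w /= uw <-]].
  split=> [|x y|x] //=; first by rewrite EM => -> ->.
  by rewrite EV => ->; rewrite oppr0.
by rewrite Egen; case: eqP uw => // ->; rewrite e_irr.
Qed.

(** Write [L] for [<Lk u>]. For a word representing [g], [D g] is the signed sum
    over its letters [u] of the indicators of the cosets [L h], where [h] is the
    part of the word after the letter (preceded by [u^-1] if the letter is
    [u^-1]). Moving a letter of [Lk u] across [u] does not change the coset, so
    this depends on [g] only; and a word has finitely many letters, so the
    support of [D g] consists of finitely many cosets. *)
Lemma wall_cocycle u : exists D : A -> A -> int,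
  [/\ forall x, D (gen u) x = `[< L u x >]%:R%R,
      forall g h x, D (g * h) x = (D g (x * h^-1)%g + D h x)%R &
      forall g, exists s : seq A, forall x, D g x != 0%R ->
        exists2 y, y \in s & L u (x * y^-1)].
Proof.
have [L1 LM LV] := link_subgroup_subgroup u.
have [|||D [Dgen DM]] := @raag_cocycle V e A int (fun h x => x * h^-1) _ _
  (fun v x => ((v == u)%:R * `[< L u x >]%:R)%R).
- by move=> x; rewrite invg1 mulg1.
- by move=> g h x; rewrite invgM mulgA.
- have Lc c x : e u c -> `[< L u (x * (gen c)^-1) >] = `[< L u x >].
    move=> uc; apply: asbool_equiv_eq; apply: generated_coset.
    by apply: generated_sub; exists c.
  move=> a b x ab; case: (eqVneq a u) => [au|_]; case: (eqVneq b u) => [bu|_].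
  + by move: ab; rewrite au bu e_irr.
  + by rewrite !mul0r addr0 add0r Lc // -au.
  + by rewrite !mul0r addr0 add0r Lc // -bu e_sym.
  + by rewrite !mul0r.
exists D; split=> //; first by move=> x; rewrite Dgen eqxx mul1r.
have D1 x : D 1 x = 0%R.
  have /eqP := DM 1 1 x; rewrite mulg1 invg1 mulg1.
  by rewrite eq_sym -subr_eq0 addrK => /eqP.
apply: raag_generated => [|v].
  split=> [|g h [s Ds] [t Dt]|g [s Ds]] /=.
  - by exists [::] => x; rewrite D1 eqxx.
  - exists ([seq y * h | y <- s] ++ t) => x; rewrite DM => Dx.
    have [/Dt [y yt Ly]|Dh] := boolP (D h x != 0%R).
      by exists y => //; rewrite mem_cat yt orbT.
    have /Ds [y ys Ly] : D g (x * h^-1) != 0%R.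
      by apply: contraNneq Dh => Dg0; move: Dx; rewrite Dg0 add0r.
    exists (y * h); first by rewrite mem_cat; apply/orP; left; apply/mapP; exists y.
    by rewrite invgM mulgA.
  - exists [seq y * g^-1 | y <- s] => x.
    have := DM g g^-1 x; rewrite mulgV D1 invgK => /esym/eqP.
    rewrite addrC addr_eq0 => /eqP ->; rewrite oppr_eq0 => /Ds [y ys Ly].
    by exists (y * g^-1); [by apply/mapP; exists y|rewrite invgM invgK mulgA].
exists [:: 1] => x; rewrite Dgen.
case: asboolP => [Lx _|_]; first by exists 1; rewrite ?inE ?invg1 ?mulg1.
by rewrite mulr0 eqxx.
Qed.

(** Comparing [D (g * u)] with [D (u * g)] at [x] gives
    [D g (x * u^-1) - D g x = 1_L (x * g^-1) - 1_L x]. If [L] contained no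
    element [u^n * g^-1], then [n |-> D g (u^n)] would be constant for
    [n >= 0] and for [n < 0], with a jump by 1 in between; so it would be
    nonzero on infinitely many of the distinct cosets [L u^n], against the
    finiteness of the support of [D g]. *)
Lemma centralizer_gen u g : commute (gen u) g ->
  exists f z, [/\ L u f, generated [set gen u] z & g = f * z].
Proof.
move=> ug; apply: contrapT => nfz.
have [L1 LM LV] := link_subgroup_subgroup u.
have [Z1 ZM ZV] := generated_subgroup [set gen u].
have Zu n : generated [set gen u] (gen u ^+ n).
  by apply: generated_expg; exact: generated_sub.
have nL z : generated [set gen u] z -> ~ L u (z * g^-1).
  move=> Zz Lz; apply: nfz; exists (z * g^-1)^-1, z; split=> //; first exact: LV.
  by rewrite invgM invgK mulgVK.
have [E Ehom] := raag_exponent e u; have [Egen EM E1 EV] := Ehom.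
have EX n : E (gen u ^+ n) = n%:Z.
  elim: n => [//|n IH].
  by rewrite expgS EM IH Egen eqxx intS.
have [D [Du DM Dfin]] := wall_cocycle u.
have Dvanish (z : nat -> A) : (forall n m, L u (z n * (z m)^-1) -> n = m) ->
    exists n, D g (z n) = 0%R.
  move=> zinj; apply: contrapT => /forallNP Dz.
  have [s Ds] := Dfin g.
  have /choice [f fP] : forall n, exists y, y \in s /\ L u (z n * y^-1).
    by move=> n; have /eqP/Ds[y ys Ly] := Dz n; exists y.
  have [|n /negP] := @injective_not_in_seq _ f s; last by case: (fP n).
  move=> n m fnm; apply: zinj.
  have [_ Ln] := fP n; have [_ Lm] := fP m.
  have -> : z n * (z m)^-1 = z n * (f n)^-1 * (z m * (f m)^-1)^-1.
    by rewrite invgM invgK fnm mulgA mulgVK.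
  by apply: LM; last exact: LV.
have key x : (D g (x * (gen u)^-1)%g + `[< L u x >]%:R =
              `[< L u (x * g^-1)%g >]%:R + D g x)%R.
  by rewrite -!Du -!DM ug.
have step x z : x = z -> generated [set gen u] x -> (E x != 0)%R ->
    D g (x * (gen u)^-1) = D g z.
  move=> <- Zx Ex; have := key x; case: asboolP => [/(link_subgroup_exponent Ehom) Ex0|_].
    by rewrite Ex0 in Ex.
  by case: asboolP => [/(nL _ Zx)//|_]; rewrite addr0 add0r.
have Dpos n : D g (gen u ^+ n) = D g 1.
  elim: n => [//|n <-]; rewrite -(step _ _ erefl) // ?EX //.
  by rewrite expgSr mulgK.
have Dneg n : D g (gen u ^- n.+1) = D g (gen u)^-1.
  elim: n => [//|n <-]; rewrite -(step _ (gen u ^- n.+1) erefl) //; last 2 first.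
  - exact: ZV.
  - by rewrite EV EX oppr_eq0.
  by rewrite -invgM -expgS.
have [n] : exists n, D g (gen u ^+ n) = 0%R.
  apply: Dvanish => i j /(link_subgroup_exponent Ehom).
  by rewrite EM EV !EX => /eqP; rewrite subr_eq0 => /eqP [].
have [m] : exists n, D g (gen u ^- n.+1) = 0%R.
  apply: Dvanish => i j /(link_subgroup_exponent Ehom).
  by rewrite EM !EV !EX opprK addrC => /eqP; rewrite subr_eq0 => /eqP [].
rewrite Dpos Dneg => D0 D1; have := key 1.
rewrite mul1g D0 D1 addr0 add0r mul1g.
by case: asboolP => // _; case: asboolP => // Lg; case: (nL 1 Z1); rewrite mul1g.
Qed.

End Centralizers.

(** * Edges of the extension graph *)

Section CommutingConjugates.
Variables (V : finType) (e : rel V).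
Hypotheses (e_sym : symmetric e) (e_irr : irreflexive e).
Local Notation A := (raag e).
Local Notation gen := (raag_gen e).
Local Open Scope group_scope.

(** After a conjugation, [gen w] commutes with [gen u ^ g], so that the latter
    lies in the subgroup generated by the star of [w]. The retraction [r] onto
    this subgroup fixes [gen u ^ g], so it does not kill [u], and
    [gen u ^ g = gen u ^ r g]. As [r g] centralizes [gen w], conjugation by
    [r g] carries the edge [w u] to the given pair. *)
Lemma ext_adjP x y : ext_adj x y <->
  exists a b (k : A), [/\ e a b, x = gen a ^ k & y = gen b ^ k].
Proof.
split=> [/asboolP [[w [h ->]] [u [g' yE]] xy cxy]|[a [b [k [ab -> ->]]]]]; last first.
  apply/asboolP; split; [by exists a, k|by exists b, k| |].
    by move=> /gen_inj abE; rewrite abE e_irr in ab.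
  exact/commute_conjg/raag_gen_commute.
pose g := g' * h^-1.
have ygh : y = (gen u ^ g) ^ h by rewrite -conjgM mulgVK yE.
clearbody g.
have wg : commute (gen w) (gen u ^ g).
  have := commute_conjg h^-1 cxy.
  by rewrite ygh !conjgK.
have [f [z [Lf Zz gE]]] := centralizer_gen e_sym e_irr wg.
pose P := [pred t | (t == w) || e w t].
have [r rP] := raag_retraction e P; have [rgen rM r1 rV] := rP.
have rf : r f = f by apply: (retraction_id (Q := e w) rP _ Lf) => v /= ->; rewrite orbT.
have rz : r z = z.
  apply: (retraction_id (Q := eq w) rP) => [v <- /=|]; first by rewrite eqxx.
  apply: generated_min Zz => [|_ ->]; first exact: generated_subgroup.
  by apply: generated_sub; exists w => //=.
have rg : gen u ^ g = r (gen u) ^ r g.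
  by rewrite -(retraction_conj _ _ rP) gE rM rf rz.
have crg : commute (gen w) (r g).
  apply: generated_commute (retraction_generated g rP) => _ [v /= + <-].
  by case/predU1P => [->//|/raag_gen_commute].
have Pu : P u.
  apply: contraT => nPu; have [E [Egen EM E1 EV]] := raag_exponent e u.
  move: rg; rewrite rgen (negbTE nPu) conj1g => /(congr1 E).
  by rewrite conjgE !EM EV Egen eqxx E1 addrCA addNr addr0.
rewrite rgen Pu in rg; case/predU1P: Pu => [uw|wu].
  by case: xy; rewrite ygh rg uw (conjg_commute crg).
exists w, u, (r g * h); split=> //; first by rewrite conjgM (conjg_commute crg).
by rewrite conjgM -rg.
Qed.

Lemma ext_adj_sym : symmetric (@ext_adj V e).
Proof.
by move=> x y; apply/idP/idP => /ext_adjP [a [b [k [ab -> ->]]]];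
  apply/ext_adjP; exists b, a, k; rewrite e_sym.
Qed.

Lemma ext_adj_conj x y g : @ext_adj V e x y -> ext_adj (x ^ g) (y ^ g).
Proof.
move=> /ext_adjP [a [b [k [ab -> ->]]]]; apply/ext_adjP.
by exists a, b, (k * g); rewrite !conjgM.
Qed.

End CommutingConjugates.

(** * Every edge of the extension graph is a bridge *)

Section Bridges.
Variables (V : finType) (e : rel V).
Hypotheses (e_sym : symmetric e) (e_irr : irreflexive e).
Local Notation A := (raag e).
Local Notation gen := (raag_gen e).
Local Open Scope group_scope.

Section EdgeCocycle.
Variables (u w : V) (side : pred V).
Hypotheses (uw : e u w) (side_u : side u = false) (side_w : side w = true).
Hypothesis side_edge : forall a b, e a b ->
  side a = side b \/ (a = u /\ b = w) \/ (a = w /\ b = u).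

Let K : set A := generated [set gen u; gen w].
Let jump (c : V) (x : A) : int :=
  (`[< K (x * (gen c)^-1)%g >]%:R - `[< K x >]%:R)%R.

Let jump0 c x : c = u \/ c = w -> jump c x = 0%R.
Proof.
move=> cuw; rewrite /jump.
have -> : `[< K (x * (gen c)^-1) >] = `[< K x >].
  apply: asbool_equiv_eq; apply: generated_coset; apply: generated_sub.
  by case: cuw => ->; [left|right].
by rewrite addrN.
Qed.

(** Without the edge [u w] the tree falls into two sides, and the group is the
    amalgam over [K = <u, w>] of the subgroups of the sides (each enlarged by
    the edge). The cocycle vanishes on the side of [u] and is the coboundary of
    the indicator of [K] on the side of [w]; the two prescriptions agree
    on [K]. It is the cocycle of the action on the Bass-Serre tree of this
    amalgam. *)
Lemma edge_cocycle : exists D : A -> A -> int,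
  [/\ forall c x, D (gen c) x = ((side c)%:R * jump c x)%R,
      forall g h x, D (g * h) x = (D g (x * h^-1)%g + D h x)%R &
      forall x, D 1 x = 0%R].
Proof.
have [|||D [Dgen DM]] := @raag_cocycle V e A int (fun h x => x * h^-1) _ _
  (fun c x => ((side c)%:R * jump c x)%R).
- by move=> x; rewrite invg1 mulg1.
- by move=> g h x; rewrite invgM mulgA.
- move=> a b x ab; case: (side_edge ab) => [sab|auw]; last first.
    have [? ?] : (a = u \/ a = w) /\ (b = u \/ b = w) by tauto.
    by rewrite !jump0 // !mulr0.
  rewrite sab -!mulrDr; congr (_ * _)%R; rewrite /jump.
  have -> : x * (gen a)^-1 * (gen b)^-1 = x * (gen b)^-1 * (gen a)^-1.
    by rewrite -!mulgA -!invgM (raag_gen_commute ab).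
  ring.
exists D; split=> // x.
have /eqP := DM 1 1 x; rewrite mulg1 invg1 mulg1.
by rewrite eq_sym -subr_eq0 addrK => /eqP.
Qed.

(** Along the edge with ends [gen a ^ k] and [gen b ^ k], the potential at [x]
    changes by [(side a - side b) * 1_K (x * k^-1)]. At [x = 1] this is nonzero
    only if the edge [a b] is [u w] and [k] lies in [K], which fixes both
    ends. *)
Lemma edge_potential : exists s : A -> int, s (gen u) <> s (gen w) /\
  forall x y, ext_adj x y -> s x <> s y ->
    (x = gen u /\ y = gen w) \/ (x = gen w /\ y = gen u).
Proof.
have [D [Dgen DM D1]] := edge_cocycle.
(* The potential of the vertex gen t ^ g; the second term is the coboundary
   that makes phi invariant under the centralizer of gen t when t is on the
   side of w. *)
pose phi (t : V) (g x : A) : int :=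
  (D g x - (side t)%:R * `[< K (x * g^-1)%g >]%:R)%R.
have phiM t c g x : commute (gen t) c -> phi t (c * g) x = phi t g x.
  pose inv_by c := forall g x, phi t (c * g) x = phi t g x.
  have inv_subgroup : is_subgroup inv_by.
    split=> [{}g {}x|a b ha hb {}g {}x|a ha {}g {}x]; first by rewrite mul1g.
      by rewrite -mulgA ha hb.
    by rewrite -(ha (a^-1 * g)) mulVKg.
  have inv_gen a : a = t \/ e t a -> inv_by (gen a).
    move=> ta {}g {}x; rewrite /phi DM Dgen invgM mulgA.
    apply/eqP; rewrite -subr_eq0; apply/eqP.
    transitivity (((side a)%:R - (side t)%:R) * jump a (x * g^-1)%g)%R.
      rewrite /jump; ring.
    have [->|sta] : side a = side t \/ (a = u \/ a = w).
      case: ta => [->|/side_edge]; first by left.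
      by case=> [->|[] [_ ->]]; [left|right; right|right; left].
      by rewrite subrr mul0r.
    by rewrite jump0 // mulr0.
  move=> /(centralizer_gen e_sym e_irr) [f [z [Lf Zz ->]]].
  suff [hf hz] : inv_by f /\ inv_by z by rewrite -mulgA hf hz.
  split; [apply: generated_min Lf|apply: generated_min Zz] => //.
    by move=> _ [a /= ta <-]; apply: inv_gen; right.
  by move=> _ ->; apply: inv_gen; left.
have /choice [s sP] : forall y, exists n, forall t g, y = gen t ^ g -> n = phi t g 1.
  move=> y; have [[t [g yE]]|ny] := pselect (ext_vertex e y); last first.
    by exists 0%R => t g yE; case: ny; exists t, g.
  exists (phi t g 1) => t' g'; rewrite yE => yy.
  have tt := gen_inj yy; subst t'.
  by rewrite -[g in LHS](mulgVK g') phiM //; apply: conjg_eq_commute.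
have K1 : K 1 by case: (generated_subgroup [set gen u; gen w]).
exists s; split.
  rewrite (sP _ u 1) ?conjg1 // (sP _ w 1) ?conjg1 // /phi side_u side_w.
  by rewrite !D1 invg1 mulg1 asboolT.
move=> x y /(ext_adjP e_sym e_irr) [a [b [k [ab -> ->]]]].
rewrite (sP _ a k) // (sP _ b k) // /phi => sab.
have Kk : K (1 * k^-1)%g.
  by apply: contrapT => nK; apply: sab; case: asboolP => // _; rewrite !mulr0.
have {sab} auw : (a = u /\ b = w) \/ (a = w /\ b = u).
  by case: (side_edge ab) => // sE; case: sab; rewrite sE.
have Kfix c : c = u \/ c = w -> gen c ^ k = gen c.
  move=> cuw; apply: conjg_commute; rewrite -[k]invgK; apply: commuteV.
  rewrite -[k^-1]mul1g; apply: generated_commute Kk => _ [->|->];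
  have := raag_gen_commute uw; case: cuw => -> // /commute_sym; exact.
have [fu fw] : gen u ^ k = gen u /\ gen w ^ k = gen w.
  by split; apply: Kfix; [left|right].
by case: auw => -[-> ->]; rewrite fu fw; [left|right].
Qed.

End EdgeCocycle.

Hypothesis e_acyclic : forall c : seq V, (2 < size c)%N -> ~~ ucycleb e c.

(** The side of [w] is what can be reached from [w] without the edge [u w]. It
    misses [u], since a simple path to [u] would close up to a cycle. *)
Lemma tree_side u w : e u w -> exists side : pred V,
  [/\ side u = false, side w = true & forall a b, e a b ->
    side a = side b \/ (a = u /\ b = w) \/ (a = w /\ b = u)].
Proof.
move=> uw; pose e' := [rel a b | e a b && ~~ ((a == u) && (b == w))
                                       && ~~ ((a == w) && (b == u))].
have e'_sym : symmetric e'.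
  move=> a b /=; rewrite e_sym; case: (e b a) => //=.
  by rewrite andbC [(a == u) && _]andbC [(a == w) && _]andbC.
exists (connect e' w); split.
- apply/negP => /connectP [p0 /shortenP [p pth + _] uE].
  rewrite /= => /andP [wp up].
  have sub : subrel e' e by move=> a b /= /andP [/andP []].
  case: p pth wp up uE => [|a p] pth wp up uE; first by rewrite /= uE e_irr in uw.
  have : ~~ ucycleb e (w :: a :: p).
    apply: e_acyclic; case: p pth {wp up} uE => //= /andP [/andP [_ h] _] ua.
    by rewrite -ua !eqxx in h.
  case/negP; apply/andP; split; last by rewrite cons_uniq wp.
  by rewrite /cycle rcons_path (sub_path sub pth) -uE.
- exact: connect0.
- move=> a b ab; have [/andP[/eqP -> /eqP ->]|nab] := boolP ((a == u) && (b == w)).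
    by right; left.
  have [/andP[/eqP -> /eqP ->]|nba] := boolP ((a == w) && (b == u)).
    by right; right.
  left; have e'ab : e' a b by rewrite /= ab nab nba.
  apply/idP/idP => wx; apply: connect_trans wx _; apply: connect1 => //.
  by rewrite e'_sym.
Qed.

Lemma ext_bridge x y : ext_adj x y -> exists s : A -> int, s x <> s y /\
  forall a b, ext_adj a b -> s a <> s b ->
    (a = x /\ b = y) \/ (a = y /\ b = x).
Proof.
move=> /(ext_adjP e_sym e_irr) [u [w [k [uw -> ->]]]].
have [side [su sw sE]] := tree_side uw.
have [s [suw sP]] := edge_potential uw su sw sE.
exists (fun z => s (z ^ k^-1)); split; first by rewrite !conjgK.
move=> a b /(ext_adj_conj e_sym e_irr k^-1) /sP ab /ab.
by case=> -[<- <-]; rewrite !conjgKV; [left|right].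
Qed.

End Bridges.

(** * Walks and distances *)

Section Walks.
Variables (T : choiceType) (adj : rel T).

Definition joined (x y : T) : Prop := exists p, walk adj x y p.

Lemma joined_geodesic x y : joined x y -> exists p, geodesic adj x y p.
Proof.
move=> [p0 w0]; have ex_n : exists n, `[< exists2 p, walk adj x y p & size p = n >].
  by exists (size p0); apply/asboolP; exists p0.
case: (ex_minnP ex_n) => n /asboolP [p wp pn] nmin; exists p; split=> // q wq.
by rewrite pn; apply: nmin; apply/asboolP; exists q.
Qed.

Lemma gdist_walk (R : realType) x y p :
  walk adj x y p -> (gdist adj R x y <= ((size p)%:R : R)%:E)%E.
Proof. by move=> wp; apply: ereal_inf_lbound; exists p. Qed.

Lemma gdist_ge0 (R : realType) x y :
  (0 <= gdist adj R x y)%E.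
Proof. by apply: le_ereal_inf_tmp => _ [p _ <-]; rewrite lee_fin. Qed.

Lemma gdist_attained (R : realType) x y :
  gdist adj R x y = +oo%E \/
  exists2 p, walk adj x y p & gdist adj R x y = ((size p)%:R : R)%:E.
Proof.
have [xy|nxy] := pselect (joined x y); last first.
  left; rewrite /gdist (_ : walk adj x y = set0) ?image_set0 ?ereal_inf0 //.
  by apply/seteqP; split=> // p wp; apply: nxy; exists p.
right; have [p [wp pmin]] := joined_geodesic xy; exists p => //.
apply/eqP; rewrite eq_le gdist_walk //=.
by apply: le_ereal_inf_tmp => _ [q wq <-]; rewrite lee_fin ler_nat pmin.
Qed.

End Walks.

(** * Projections in a graph whose edges are bridges *)

Section BridgedGraph.
Variables (T : choiceType) (adj : rel T).

Definition graph_proj (x y : T) : set T :=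
  [set z | adj x z /\ exists2 p, geodesic adj x y p & z \in x :: p].

(** Instead of the components left by the removal of an edge, a function on
    the vertices that changes across this edge only. *)
Definition bridge (x y : T) (s : T -> int) : Prop :=
  s x <> s y /\ forall a b, adj a b -> s a <> s b ->
    (a = x /\ b = y) \/ (a = y /\ b = x).

Hypothesis adj_bridge : forall x y, adj x y -> exists s, bridge x y s.

Lemma adj_neq x y : adj x y -> x <> y.
Proof. by move=> /adj_bridge [s [sxy _]] xy; apply: sxy; rewrite xy. Qed.

Lemma bridge_path x z s a p : bridge x z s -> path adj a p ->
  x \notin a :: p \/ z \notin a :: p -> s (last a p) = s a.
Proof.
move=> [_ sE]; elim: p a => //= b p IH a /andP [ab pth] out.
rewrite IH //; last by case: out; rewrite inE negb_or => /andP [_]; tauto.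
apply: contrapT => sba; have /(sE _ _ ab) : s a <> s b by exact: nesym.
by case=> -[aE bE]; move: out; rewrite aE bE !inE !eqxx !orbT; case.
Qed.

Lemma geodesic_head x y z q : geodesic adj x y (z :: q) -> x \notin z :: q.
Proof.
move=> [[pth lst] gmin]; apply/negP => /splitPr xq; move: xq pth lst gmin.
case=> p1 p2; rewrite cat_path last_cat size_cat /= => /and3P [_ _ pth] lst gmin.
have := gmin p2 (conj pth lst).
by rewrite addnS ltnNge leq_addl.
Qed.

(** A geodesic from [x] that meets the neighbour [z] starts with the edge [x z]
    and never returns to it; a walk from [x] that avoids [z] does not cross
    this edge at all. *)
Lemma graph_projP x y z s : joined adj x y -> adj x z -> bridge x z s ->
  graph_proj x y z <-> s y <> s x.
Proof.
move=> xy xz sP; split=> [[_ [p gp zp]]|syx]; last first.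
  have [p gp] := joined_geodesic xy; split=> //; exists p => //.
  apply: contraT => zp; case: syx; case: gp => -[pth <-] _.
  by apply: (bridge_path sP pth); right.
have zx : z != x by apply/eqP => /esym; exact: adj_neq.
rewrite inE (negbTE zx) /= in zp.
case/splitPr: zp gp => p1 p2 gp.
have p10 : p1 = [::].
  case: gp => -[pth lst] gmin; move: pth lst; rewrite cat_path last_cat /=.
  move=> /and3P [_ _ pth] lst.
  have wz : walk adj x y (z :: p2) by split=> //=; rewrite xz.
  have := gmin _ wz; rewrite size_cat /=.
  by case: (p1) => //= ? ?; rewrite addSn ltnNge leq_addl.
rewrite p10 /= in gp; have xp := geodesic_head gp.
case: gp => -[/= /andP [_ pth] <-] _.
rewrite (bridge_path sP pth); last by left.
by case: sP => h _; exact: nesym.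
Qed.

Lemma graph_proj_adj x y : adj x y -> graph_proj x y = [set y].
Proof.
move=> xy; have jxy : joined adj x y by exists [:: y]; split=> //=; rewrite xy.
have [s sP] := adj_bridge xy.
apply/seteqP; split=> [z xyz|_ ->]; last first.
  by apply/(graph_projP jxy xy sP); case: sP => h _; exact: nesym.
have xz : adj x z by case: xyz.
have [s' s'P] := adj_bridge xz.
have := (graph_projP jxy xz s'P).1 xyz => /nesym.
case: s'P => _ /[apply]-/(_ xy) [[_ ->//]|[xz' _]].
by case: (adj_neq xz).
Qed.

(** The edge [y y'] avoids [x], so no potential of an edge at [x] changes
    along it. *)
Lemma graph_proj_step x y y' : joined adj x y -> adj y y' -> x <> y -> x <> y' ->
  graph_proj x y = graph_proj x y'.
Proof.
move=> xy yy' nxy nxy'.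
have xy' : joined adj x y'.
  case: xy => p [pth lst]; exists (rcons p y').
  by split; rewrite ?last_rcons // rcons_path pth lst.
have sE z : adj x z -> forall s, bridge x z s -> s y = s y'.
  move=> xz s sP; have := bridge_path (a := y) (p := [:: y']) sP.
  rewrite /= yy' => /(_ isT) ->//; left.
  by rewrite !inE negb_or; apply/andP; split; exact/eqP.
apply/seteqP; split=> z zP.
  have xz : adj x z by case: zP.
  have [s sP] := adj_bridge xz; apply/(graph_projP xy' xz sP).
  by rewrite -(sE z xz s sP); apply/(graph_projP xy xz sP).
have xz : adj x z by case: zP.
have [s sP] := adj_bridge xz; apply/(graph_projP xy xz sP).
by rewrite (sE z xz s sP); apply/(graph_projP xy' xz sP).
Qed.

Lemma graph_proj_path x y q : joined adj x y -> path adj y q -> x \notin y :: q ->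
  graph_proj x y = graph_proj x (last y q).
Proof.
elim: q y => //= y' q IH y xy /andP [yy' pth].
rewrite inE negb_or => /andP [/eqP nxy nxq].
have nxy' : x <> y' by move=> xy'; rewrite xy' inE eqxx in nxq.
rewrite (graph_proj_step xy yy' nxy nxy') IH //.
case: xy => p [pthp lst]; exists (rcons p y').
by split; rewrite ?last_rcons // rcons_path pthp lst.
Qed.

Lemma graph_proj_self x : graph_proj x x = set0.
Proof.
apply/seteqP; split=> // z [xz [p [_ gmin] zp]].
have := gmin [::] (conj isT erefl).
rewrite leqn0 size_eq0 => /eqP p0; move: zp; rewrite p0 inE => /eqP zx.
by case: (adj_neq xz).
Qed.

Lemma graph_proj_single x y : joined adj x y -> x <> y ->
  exists2 z, adj x z & graph_proj x y = [set z].
Proof.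
move=> xy nxy; have [[|z q] gq] := joined_geodesic xy.
  by case: gq => -[_ /= /nxy].
have xz : adj x z by case: gq => -[/= /andP []].
exists z => //; rewrite -(graph_proj_adj xz).
have xq := geodesic_head gq; case: gq => -[/= /andP [_ pth] <-] _.
apply: esym; apply: graph_proj_path => //.
by exists [:: z]; split=> //=; rewrite xz.
Qed.

End BridgedGraph.

(** * Galleries *)

Section Galleries.
Variables (V : finType) (e : rel V).
Hypotheses (e_sym : symmetric e) (e_irr : irreflexive e).
Hypothesis e_conn : forall x y, connect e x y.
Local Notation A := (raag e).
Local Notation gen := (raag_gen e).
Local Notation eadj := (@ext_adj V e).
Local Open Scope group_scope.

(** A pair [(t, k)] is a vertex of the extension graph with a conjugator. *)
Definition pair_vertex (a : V * A) : A := gen a.1 ^ a.2.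
Local Notation vx := pair_vertex.

(** The conjugators at both ends of a step agree on both vertices. Hence any two
    consecutive steps are conjugated by a single element, the conjugator in the
    middle, from a path of the defining tree. *)
Definition gallery_step : rel (V * A) := fun a b =>
  [&& e a.1 b.1, gen a.1 ^ a.2 == gen a.1 ^ b.2 & gen b.1 ^ a.2 == gen b.1 ^ b.2].

Definition gallery (n : nat) (a b : V * A) : Prop :=
  exists p, [/\ path gallery_step a p, last a p = b & (size p <= n)%N].

Lemma gallery_step_sym : symmetric gallery_step.
Proof.
move=> a b; rewrite /gallery_step e_sym (eq_sym (gen b.1 ^ b.2)).
by rewrite (eq_sym (gen a.1 ^ b.2)); congr (_ && _); exact: andbC.
Qed.

Lemma gallery_sym n a b : gallery n a b -> gallery n b a.
Proof.
move=> [p [pth lst sz]]; exists (rev (belast a p)).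
split; last by rewrite size_rev size_belast.
- rewrite -lst rev_path; apply: sub_path pth => c d.
  by rewrite gallery_step_sym.
- by case: p {pth sz} lst => [|c p] //= _; rewrite rev_cons last_rcons.
Qed.

Lemma gallery_trans m n a b c :
  gallery m a b -> gallery n b c -> gallery (m + n) a c.
Proof.
move=> [p [pth lst sz]] [q [qth <- sz']]; exists (p ++ q).
by rewrite cat_path last_cat lst pth qth size_cat leq_add.
Qed.

Lemma gallery_le m n a b : (m <= n)%N -> gallery m a b -> gallery n a b.
Proof. by move=> mn [p [? ? sz]]; exists p; split=> //; exact: leq_trans mn. Qed.

Lemma gallery1 a b : gallery_step a b -> gallery 1 a b.
Proof. by move=> ab; exists [:: b]; rewrite /= ab. Qed.

Lemma gallery_path t p k : path e t p -> gallery (size p) (t, k) (last t p, k).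
Proof.
move=> pth; exists (map (pair^~ k) p); split; last by rewrite size_map.
  elim: p t pth => //= s p IH t /andP [ts /IH ->].
  by rewrite /gallery_step /= ts !eqxx.
exact: (last_map (pair^~ k)).
Qed.

Lemma gallery_step_adj a b : gallery_step a b -> eadj (vx a) (vx b).
Proof.
move=> /and3P [ab /eqP aE _]; apply/(ext_adjP e_sym e_irr).
by exists a.1, b.1, b.2.
Qed.

Lemma gallery_vertex_path a p :
  path gallery_step a p -> path eadj (vx a) (map vx p).
Proof.
by elim: p a => //= b p IH a /andP [/gallery_step_adj -> /IH].
Qed.

Section Diameter.
Variable D : nat.
Hypotheses (D_pos : (0 < D)%N).
Hypothesis D_walk : forall x y : V, exists p, walk e x y p /\ (size p <= D)%N.
Hypothesis V2 : (1 < #|V|)%N.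

Lemma neighbor_ex v : exists w, e v w.
Proof.
have /card_gt1P [x [y [_ _ xy]]] := V2.
have [w wv] : exists w, w != v.
  by have [<-|xv] := eqVneq x v; [exists y; rewrite eq_sym|exists x].
have /connectP [[|t p] /= pth lst] := e_conn v w.
  by rewrite lst eqxx in wv.
by exists t; case/andP: pth.
Qed.

(** If [s] is a power of [w], follow the conjugate by [s * k] of a path of the
    tree from [v] towards [w], change the conjugator to [k] when crossing the
    last edge, whose ends commute with [s], and walk back. *)
Lemma gallery_syllable v (s k : A) : syllable s ->
  gallery (D + D) (v, s * k) (v, k).
Proof.
move=> [w ws].
have [y [t [p [pth lst sz yt [sy st]]]]] : exists y t p,
    [/\ path e v p, last v p = y, (size p < D)%N, e y t &
        commute (gen y) s /\ commute (gen t) s].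
  have [p [[pth lst] sz]] := D_walk v w.
  (* When w = v there is no last edge, and any edge at v does. *)
  case/lastP: p pth lst sz => [_ /= vw _|p t].
    have [t vt] := neighbor_ex v; exists v, t, [::]; split=> //.
    by split; apply: cyclic_commute ws _; rewrite -vw;
      [exact: commute_refl|apply/commute_sym/raag_gen_commute].
  rewrite rcons_path last_rcons size_rcons => /andP [pth pt] tw sz.
  exists (last v p), t, p; split=> //.
  by split; apply: cyclic_commute ws _; rewrite -tw;
    [exact/raag_gen_commute|exact: commute_refl].
have yy : gallery (1 + 1) (y, s * k) (y, k).
  apply: (gallery_trans (b := (t, k))); apply: gallery1.
    by rewrite /gallery_step /= yt !conjgM (conjg_commute sy) (conjg_commute st) !eqxx.
  by rewrite /gallery_step /= e_sym yt !eqxx.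
have vy k' := gallery_path k' pth; rewrite lst in vy.
apply: gallery_le (gallery_trans (vy _) (gallery_trans yy (gallery_sym (vy _)))).
by move: sz; clear; lia.
Qed.

Lemma gallery_syllable_prod v g l : syllable_prod g l ->
  gallery (l * (D + D)) (v, g) (v, 1).
Proof.
move=> [s [<- ss ->]] {g l}; elim: s ss => [|a s IH] ss.
  by rewrite big_nil; exists [::].
rewrite big_cons mulSn; apply: gallery_trans (IH _); last first.
  by move=> b bs; apply: ss; rewrite inE bs orbT.
by apply: gallery_syllable; apply: ss; rewrite inE eqxx.
Qed.

Lemma ext_joined x y : ext_vertex e x -> ext_vertex e y -> joined eadj x y.
Proof.
suff h v w g k : joined eadj (gen v ^ g) (gen w ^ k).
  by move=> [v [g ->]] [w [k ->]].
have to_one u c : exists n, gallery n (u, c) (v, 1).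
  have [p [[pth lst] _]] := D_walk u v.
  have [l /asboolP lP] := syllable_prod_ex c.
  exists (size p + l * (D + D))%N; apply: gallery_trans (gallery_path _ pth) _.
  by rewrite lst; exact: gallery_syllable_prod.
have [m vm] := to_one v g; have [n wn] := to_one w k.
have [p [pth lst _]] := gallery_trans vm (gallery_sym wn).
exists (map vx p); split; first exact: (gallery_vertex_path pth).
by rewrite -[gen v ^ g]/(vx (v, g)) last_map lst.
Qed.

End Diameter.
End Galleries.

(** * Distances in links, from above *)

Section LinkMetric.
Variables (V : finType) (e : rel V).
Hypotheses (e_sym : symmetric e) (e_irr : irreflexive e).
Hypothesis e_acyclic : forall c : seq V, (2 < size c)%N -> ~~ ucycleb e c.
Hypothesis ext_conn : forall x y, ext_vertex e x -> ext_vertex e y ->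
  joined (@ext_adj V e) x y.
Local Notation A := (raag e).
Local Notation gen := (raag_gen e).
Local Notation L u := (@link_subgroup V e u).
Local Notation eadj := (@ext_adj V e).
Local Notation vx := (@pair_vertex V e).
Local Open Scope group_scope.

(** The powers of [u] act trivially on the link of [u], so only the factor in
    [<Lk u>] of an element of the centralizer matters there. *)
Lemma centralizer_link_conj u g : commute (gen u) g ->
  exists f z, [/\ L u f, generated [set gen u] z, g = z * f &
    forall a, e u a -> gen a ^ g = gen a ^ f].
Proof.
move=> /(centralizer_gen e_sym e_irr) [f [z [Lf Zz gE]]].
have fz : commute f z.
  by apply: cyclic_commute Zz _; apply/commute_sym/link_subgroup_commute.
exists f, z; split=> //; first by rewrite gE.
move=> a ua; rewrite gE fz conjgM (conjg_commute (g := z)) //.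
by apply: cyclic_commute Zz _; apply/commute_sym/raag_gen_commute.
Qed.

(** Bounds by a natural number on the distance in the link of [gen u ^ h], for
    any representative [(u, h)] of this vertex. *)
Definition link_near (u : V) (h : A) (n : nat) (y z : A) : Prop :=
  exists2 p, walk (@base_link_adj V e u) (y ^ h^-1) (z ^ h^-1) p & (size p <= n)%N.

Lemma link_near_trans u h m n x y z :
  link_near u h m x y -> link_near u h n y z -> link_near u h (m + n) x z.
Proof.
move=> [p [pth lst] sz] [q [qth qlst] sz']; exists (p ++ q).
  by split; rewrite ?cat_path ?last_cat lst // pth qth.
by rewrite size_cat leq_add.
Qed.

Lemma link_near_turn u h a b c :
  gallery_step a b -> gallery_step b c -> vx b = gen u ^ h ->
  link_near u h 1 (vx a) (vx c).
Proof.
move=> /and3P [ab /eqP aE _] /and3P [bc _ /eqP cE] bu.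
have bu1 := gen_inj bu; rewrite /pair_vertex bu1 in bu.
have [f [z [Lf Zz _ fE]]] := centralizer_link_conj (conjg_eq_commute bu).
have ua : e u a.1 by rewrite -bu1 e_sym.
have uc : e u c.1 by rewrite -bu1.
rewrite /link_near /pair_vertex aE -cE -!conjgM !fE //.
have [->|ac] := eqVneq (gen a.1 ^ f) (gen c.1 ^ f); first by exists [::].
exists [:: gen c.1 ^ f] => //; split=> //=; rewrite andbT.
by apply/asboolP; split; [exact/eqP|exists a.1, c.1, f].
Qed.

(** The projection to the link of a vertex stays constant as long as the gallery
    avoids this vertex, and each visit moves it by at most 1. *)
Lemma gallery_link_near u h n p a : (size p <= n)%N ->
  path (@gallery_step V e) a p -> gen u ^ h <> vx a ->
  gen u ^ h <> vx (last a p) ->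
  exists y z, [/\ graph_proj eadj (gen u ^ h) (vx a) = [set y],
    graph_proj eadj (gen u ^ h) (vx (last a p)) = [set z] &
    link_near u h (count_mem (gen u ^ h) (map vx p)) y z].
Proof.
set x := gen u ^ h.
have jx b : joined eadj x (vx b) by apply: ext_conn; [exists u, h|exists b.1, b.2].
have esym := ext_adj_sym e_sym e_irr.
have ebr := fun x y => @ext_bridge V e e_sym e_irr e_acyclic x y.
elim: n p a => [|n IH] [|b q] a //= sz.
- move=> _ xa _; have [y _ yE] := graph_proj_single ebr (jx a) xa.
  by exists y, y; split=> //; exists [::].
- move=> _ xa _; have [y _ yE] := graph_proj_single ebr (jx a) xa.
  by exists y, y; split=> //; exists [::].
move=> /andP [ab pth] xa xlast.
have abj := gallery_step_adj e_sym e_irr ab.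
have [bx|/eqP bx] := eqVneq (vx b) x; last first.
  have [y [z [yE zE yz]]] := IH q b sz pth (nesym bx) xlast.
  exists y, z; split=> //.
  by rewrite (graph_proj_step ebr (jx a) abj xa (nesym bx)).
case: q sz pth xlast => [_ _ /=|c q /= sz /andP [bc pth] xlast].
  by rewrite bx.
have bcj := gallery_step_adj e_sym e_irr bc.
have xc : x <> vx c by have := adj_neq ebr bcj; rewrite bx.
have [y [z [yE zE yz]]] := IH q c (ltnW sz) pth xc xlast.
exists (vx a), z; split=> //.
  by apply: (graph_proj_adj ebr); rewrite -bx esym.
have xcE : graph_proj eadj x (vx c) = [set vx c].
  by apply: (graph_proj_adj ebr); rewrite -bx.
have yc : y = vx c by have : [set y] y by []; rewrite -yE xcE.
have -> : (vx c == x) = false by apply/negbTE/eqP/nesym.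
by rewrite yc in yz; apply: link_near_trans yz; exact: link_near_turn bx.
Qed.

Lemma link_dist_ge0 (R : realType) (x y z : A) : (0 <= link_dist R x y z)%E.
Proof.
by rewrite /link_dist; case: pselect => // ?; case: (sval _) => ? ?; exact: gdist_ge0.
Qed.

Lemma link_dist_set_ge0 (R : realType) (x : A) P Q :
  (0 <= link_dist_set R x P Q)%E.
Proof. by rewrite /link_dist_set; case: asboolP => // _; exact: link_dist_ge0. Qed.

Lemma link_dist_set1 (R : realType) (x y z : A) :
  link_dist_set R x [set y] [set z] = link_dist R x y z.
Proof.
rewrite /link_dist_set asboolT; last by split; [exists y|exists z].
by rewrite (xget_unique 1 (erefl : [set y] y)) ?(xget_unique 1 (erefl : [set z] z)).
Qed.

Lemma link_distP (R : realType) (x y z : A) : ext_vertex e x ->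
  exists u h, x = gen u ^ h /\
    link_dist R x y z = gdist (@base_link_adj V e u) R (y ^ h^-1) (z ^ h^-1).
Proof.
move=> [u [h xE]]; rewrite /link_dist; case: pselect => [xP|]; last first.
  by case; exists (u, h).
case: (cid xP) => -[u' h'] /= xE'.
by exists u', h'.
Qed.

(** Where an end of the gallery is [x] itself, its projection is empty and the
    term is 0. *)
Lemma gallery_term_le (R : realType) (x : A) a p : ext_vertex e x ->
  path (@gallery_step V e) a p ->
  (link_dist_set R x (link_proj x (vx a)) (link_proj x (vx (last a p))) <=
   ((count_mem x (map vx p))%:R : R)%:E)%E.
Proof.
move=> ex pth; have ebr := fun x y => @ext_bridge V e e_sym e_irr e_acyclic x y.
have proj_self (y : A) : ~ (link_proj y y !=set0).
  by move/set0P; rewrite -[link_proj y y]/(graph_proj eadj y y)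
    (graph_proj_self ebr) eqxx.
have [xa|/eqP xa] := eqVneq x (vx a).
  rewrite /link_dist_set asboolF ?lee_fin // -xa => -[xx _].
  exact: proj_self xx.
have [xl|/eqP xl] := eqVneq x (vx (last a p)).
  rewrite /link_dist_set asboolF ?lee_fin // -xl => -[_ xx].
  exact: proj_self xx.
have jx b : joined eadj x (vx b) by apply: ext_conn => //; exists b.1, b.2.
have [y _ yE] := graph_proj_single ebr (jx a) xa.
have [z _ zE] := graph_proj_single ebr (jx (last a p)) xl.
rewrite -![link_proj x _]/(graph_proj eadj x _) yE zE link_dist_set1.
have [u [h [xE ->]]] := link_distP R y z ex; rewrite xE in xa xl yE zE *.
have [y' [z' []]] := gallery_link_near (leqnn _) pth xa xl.
rewrite yE zE => yy zz [q wq sz].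
have yE' : y = y' by have : [set y] y by []; rewrite yy.
have zE' : z = z' by have : [set z] z by []; rewrite zz.
rewrite yE' zE'; apply: (le_trans (gdist_walk R wq)).
by rewrite lee_fin ler_nat.
Qed.

Lemma gallery_esum_le (R : realType) a p : path (@gallery_step V e) a p ->
  (\esum_(x in ext_vertex e)
     link_dist_set R x (link_proj x (vx a)) (link_proj x (vx (last a p))) <=
   ((size p)%:R : R)%:E)%E.
Proof.
move=> pth; apply: ge_ereal_sup => _ [X [finX XV] <-].
rewrite fsbig_finite //=; rewrite big_seq.
apply: le_trans (lee_sum (g := fun x => ((count_mem x (map vx p))%:R : R)%:E) _ _) _.
  by move=> x; rewrite in_fset_set // inE => /XV xV; exact: gallery_term_le.
rewrite -big_seq sumEFin lee_fin -natr_sum ler_nat -(size_map vx p).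
exact/sum_count_mem/finmap.fset_uniq.
Qed.

End LinkMetric.

(** * Syllable length *)

Section SyllableLength.
Variables (V : finType) (e : rel V).
Local Notation A := (raag e).
Local Open Scope group_scope.

Lemma syllable_prod1 (a : A) : syllable a -> syllable_prod a 1.
Proof.
move=> sa; exists [:: a]; split=> //; last by rewrite big_seq1.
by move=> b; rewrite inE => /eqP ->.
Qed.

Lemma syllable_prodM (g h : A) m n :
  syllable_prod g m -> syllable_prod h n -> syllable_prod (g * h) (m + n).
Proof.
move=> [s [<- ss ->]] [t [<- tt ->]]; exists (s ++ t).
split; [by rewrite size_cat| |by rewrite big_cat].
by move=> a; rewrite mem_cat => /orP[/ss|/tt].
Qed.

Lemma syl_le (g : A) n : syllable_prod g n -> (syl g <= n)%N.
Proof. by move=> gn; rewrite /syl; case: ex_minnP => m _; apply; apply/asboolP. Qed.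

Lemma syllable_prod_syl (g : A) : syllable_prod g (syl g).
Proof. by rewrite /syl; case: ex_minnP => m /asboolP. Qed.

End SyllableLength.

(** * Distances in links, from below *)

Section LinkSyllables.
Variables (V : finType) (e : rel V).
Hypotheses (e_sym : symmetric e) (e_irr : irreflexive e).
Hypothesis e_acyclic : forall c : seq V, (2 < size c)%N -> ~~ ucycleb e c.
Local Notation A := (raag e).
Local Notation gen := (raag_gen e).
Local Notation L u := (@link_subgroup V e u).
Local Notation eadj := (@ext_adj V e).
Local Open Scope group_scope.

Lemma no_triangle u w t : e u w -> e w t -> e u t = false.
Proof.
move=> uw wt; apply/negbTE/negP => ut.
have := @e_acyclic [:: u; w; t] isT; rewrite /ucycleb /= uw wt e_sym ut /=.
rewrite !inE negb_or andbT.
have nE a b : e a b -> a == b = false.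
  by move=> ab; apply/negP => /eqP abE; rewrite abE e_irr in ab.
by rewrite (nE u w) // (nE u t) // (nE w t).
Qed.

(** A tree has no triangles, so the retraction onto [<Lk u>] kills [Lk w] and
    leaves only the power of [w]. *)
Lemma link_centralizer u w f :
  e u w -> L u f -> commute (gen w) f -> generated [set gen w] f.
Proof.
move=> uw Lf /(centralizer_gen e_sym e_irr) [l [z [Ll Zz fE]]].
have [r rP] := raag_retraction e (e u); have [rgen rM r1 rV] := rP.
have rf : r f = f by apply: (retraction_id rP _ Lf).
have rl : r l = 1.
  apply: (generated_min (H := [set l | r l = 1])) Ll; last first.
    by move=> _ [t /= wt <-] /=; rewrite rgen (no_triangle uw wt).
  split=> [|a b|a] //=; first by rewrite rM => -> ->; rewrite mulg1.
  by rewrite rV => ->; rewrite invg1.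
have rz : r z = z.
  apply: (retraction_id (Q := eq w) rP) => [v <-//|].
  apply: generated_min Zz => [|_ ->]; first exact: generated_subgroup.
  by apply: generated_sub; exists w.
by rewrite -rf fE rM rl rz mul1g.
Qed.

(** Consecutive vertices of a walk in the link have a common conjugator, and two
    conjugators in [<Lk u>] of the same vertex [gen w ^ a] differ by a power
    of [w]: each vertex of the walk contributes one syllable. *)
Lemma link_walk_syllables u w1 w2 a b p :
  path (@base_link_adj V e u) (gen w1 ^ a) p ->
  last (gen w1 ^ a) p = gen w2 ^ b ->
  e u w1 -> L u a -> L u b -> syllable_prod (b * a^-1) (size p).+1.
Proof.
have [L1 LM LV] := link_subgroup_subgroup e u.
have turn w c d : e u w -> L u c -> L u d -> gen w ^ c = gen w ^ d ->
    syllable_prod (d * c^-1) 1.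
  move=> uw Lc Ld cd; apply: syllable_prod1; exists w.
  apply: (link_centralizer uw); first by apply: LM => //; exact: LV.
  exact: conjg_eq_commute.
elim: p w1 a => [|y p IH] w1 a /=.
  move=> _ /[dup] /gen_inj <- ab uw La Lb; exact: turn ab.
move=> /andP [/asboolP [_ [w [w' [h [uw uw' Lh ah yE]]]]] pth] lst uw1 La Lb.
rewrite yE in pth lst.
have -> : b * a^-1 = (b * h^-1) * (h * a^-1) by rewrite mulgA mulgVK.
rewrite -addn1; apply: syllable_prodM; first exact: (IH w').
by have w1w := gen_inj ah; rewrite -w1w in ah; exact: turn ah.
Qed.

(** A walk of length [m] accounts for [m + 1] syllables. The remaining one is a
    power of [u], by which the conjugators of [gen u ^ k] may also differ. *)
Lemma link_dist_syllables (R : realType) u w w' k k' :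
  e u w -> e u w' -> gen u ^ k = gen u ^ k' -> gen w ^ k <> gen w' ^ k' ->
  let d := link_dist R (gen u ^ k) (gen w ^ k) (gen w' ^ k') in
  d = +oo%E \/ exists m, [/\ d = (m%:R)%:E, (0 < m)%N
                           & syllable_prod (k' * k^-1) (m + 2)].
Proof.
move=> uw uw' kk' ww' d.
have [u0 [h [uE dE]]] : exists u0 h, gen u ^ k = gen u0 ^ h /\
    d = gdist (@base_link_adj V e u0) R ((gen w ^ k) ^ h^-1) ((gen w' ^ k') ^ h^-1).
  by apply: link_distP; exists u, k.
have u0E := gen_inj uE; subst u0.
have [d_oo|[p [pth lst] dp]] := gdist_attained (@base_link_adj V e u) R
    ((gen w ^ k) ^ h^-1) ((gen w' ^ k') ^ h^-1); first by left; rewrite dE.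
right; exists (size p); rewrite dE dp; split=> //.
  by case: p lst {pth dp} => //= /conjg_inj /ww'.
have [f1 [z1 [Lf1 Zz1 kE f1E]]] :=
  centralizer_link_conj e_sym e_irr (conjg_eq_commute uE).
have [f2 [z2 [Lf2 Zz2 k'E f2E]]] :=
  centralizer_link_conj e_sym e_irr (conjg_eq_commute (etrans (esym kk') uE)).
have [L1 LM LV] := link_subgroup_subgroup e u.
have [Z1 ZM ZV] := generated_subgroup [set gen u].
rewrite -!conjgM !f1E // !f2E // in pth lst.
have f21 := link_walk_syllables pth lst uw Lf1 Lf2.
have -> : k' * k^-1 = (z2 * z1^-1) * (f2 * f1^-1).
  have -> : k' * k^-1 = (k' * h^-1) * (k * h^-1)^-1.
    by rewrite invgM invgK mulgA mulgVK.
  rewrite kE k'E invgM -!mulgA; congr (_ * _); rewrite mulgA.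
  apply: (cyclic_commute (ZV _ Zz1)); apply/commute_sym/link_subgroup_commute.
  by apply: LM => //; exact: LV.
rewrite addn2 -add1n; apply: syllable_prodM f21.
apply: syllable_prod1; exists u; apply: ZM => //; exact: ZV.
Qed.

Hypothesis ext_conn : forall x y, ext_vertex e x -> ext_vertex e y ->
  joined (@ext_adj V e) x y.

Section Term.
Variables (R : realType) (X0 X1 : A).
Let c x := link_dist_set R x (link_proj x X0) (link_proj x X1).

(** Induction along a simple path that starts with the edge [y x] and ends at
    [X1]: each interior vertex lets the conjugator of the edge change by
    [m + 2] syllables, where [m] is its term in the sum. The path does not
    backtrack, so [m >= 1] and [m + 2 <= 3 * m]. The hypothesis on the
    projections says that [X0] lies behind [y]; it passes on to the next
    edge. *)
Lemma path_syllables q y x w u k :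
  x = gen u ^ k -> y = gen w ^ k -> e w u -> path eadj x q ->
  uniq (y :: x :: q) -> last x q = X1 ->
  (forall x', x' \in x :: q -> link_proj x' X0 = link_proj x' y) ->
  exists t k' n, [/\ X1 = gen t ^ k', syllable_prod (k' * k^-1) n &
    ((n%:R : R)%:E <= 3%:E * \sum_(x' <- belast x q) c x')%E].
Proof.
have ebr := fun x y => @ext_bridge V e e_sym e_irr e_acyclic x y.
have adjV a b : eadj a b -> ext_vertex e a /\ ext_vertex e b.
  by move=> /asboolP [].
elim: q y x w u k => [|z q IH] y x w u k xE yE wu /=.
  move=> _ _ <- _; exists u, k, 0; split=> //; last by rewrite big_nil mule0.
  by rewrite mulgV; exists [::]; rewrite big_nil.
move=> /andP [xz pth] uq lst projX0.
have [a [b [k2 [ab xE' zE]]]] := (ext_adjP e_sym e_irr x z).1 xz.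
have au : a = u by move: xE'; rewrite xE => /gen_inj.
rewrite {a}au in ab xE'.
have yx : eadj y x by apply/(ext_adjP e_sym e_irr); exists w, u, k.
have [yV xV] := adjV _ _ yx; have [_ zV] := adjV _ _ xz.
move: uq => /and3P [yxq xzq uq].
have yzq : y \notin z :: q by move: yxq; rewrite inE negb_or => /andP [].
have vq x' : x' \in z :: q -> ext_vertex e x'.
  rewrite inE => /predU1P[->//|]; move: pth; clear -adjV.
  elim: q z => //= d q IH z /andP [/adjV[_ dV] /IH {}IH].
  by rewrite inE => /predU1P[->|].
have [|//||t [k' [n [X1E n_prod n_le]]]] := IH x z u b k2 zE xE' ab pth.
- by rewrite cons_uniq xzq.
- move=> x' x'q; rewrite projX0; last by rewrite in_cons x'q orbT.
  apply: (graph_proj_step ebr) => //; first exact: (ext_conn (vq _ x'q) yV).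
    by move=> x'y; rewrite -x'y x'q in yzq.
  by move=> x'x; rewrite -x'x x'q in xzq.
have cE : c x = link_dist R (gen u ^ k) (gen w ^ k) (gen b ^ k2).
  rewrite /c projX0 ?inE ?eqxx // -lst -[link_proj x (last z q)]/(graph_proj eadj x _).
  rewrite -(graph_proj_path ebr (ext_conn xV zV) pth xzq) (graph_proj_adj ebr xz).
  rewrite -[link_proj x y]/(graph_proj eadj x _) (graph_proj_adj ebr (y := y)).
    by rewrite link_dist_set1 xE yE zE.
  by rewrite ext_adj_sym.
have cge0 x' : (0 <= c x')%E by exact: link_dist_set_ge0.
have sum_ge0 s : (0 <= \sum_(x' <- s) c x')%E by apply: sume_ge0.
have uw : e u w by rewrite e_sym.
have yz : gen w ^ k <> gen b ^ k2.
  by rewrite -yE -zE => yz; rewrite yz inE eqxx in yzq.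
have [] := link_dist_syllables R uw ab (etrans (esym xE) xE') yz.
  move=> doo; have [l /asboolP lP] := syllable_prod_ex (k' * k^-1).
  exists t, k', l; split=> //; rewrite big_cons cE doo addye.
    by rewrite gt0_muley ?leey // lte_fin ltr0n.
  by rewrite -ltNye (lt_le_trans _ (sum_ge0 _)) // ltNye.
move=> [m [dm m_pos m_prod]]; exists t, k', (n + (m + 2))%N; split=> //.
  have -> : k' * k^-1 = (k' * k2^-1) * (k2 * k^-1) by rewrite mulgA mulgVK.
  exact: syllable_prodM.
rewrite big_cons ge0_muleDr // cE dm natrD EFinD addeC; apply: leeD => //.
rewrite -EFinM lee_fin natrD; have : (1 <= m%:R :> R)%R by rewrite ler1n.
lra.
Qed.

End Term.
End LinkSyllables.

(** * Leaves and diameter of a finite tree *)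

Section Tree.
Variables (V : finType) (e : rel V).
Hypotheses (e_sym : symmetric e) (e_irr : irreflexive e).
Hypothesis e_conn : forall x y, connect e x y.
Hypothesis e_acyclic : forall c : seq V, (2 < size c)%N -> ~~ ucycleb e c.
Hypothesis V2 : (1 < #|V|)%N.

(** The first vertex of a simple path of maximal length is a leaf. *)
Lemma leaf_ex : exists v w, e v w /\ forall t, e v t -> t = w.
Proof.
pose upath n := `[< exists x p, [/\ path e x p, uniq (x :: p) & size p = n] >].
have [x0 [y0 [_ _ xy0]]] := card_gt1P V2.
have [y1 xy1] := neighbor_ex e_conn V2 x0.
have up1 : upath 1.
  apply/asboolP; exists x0, [:: y1]; split=> //=; first by rewrite xy1.
  by rewrite inE andbT; apply/eqP => xyE; rewrite xyE e_irr in xy1.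
have up_max n : upath n -> (n <= #|V|)%N.
  move=> /asboolP [x [p [_ up <-]]]; apply: ltnW.
  by rewrite -[(size p).+1]/(size (x :: p)) -(card_uniqP up) max_card.
case: (ex_maxnP (ex_intro _ 1%N up1) up_max) => n /asboolP [x [p [pth up pn]]] nmax.
have n_pos := nmax _ up1.
case: p pth up pn => [_ _ pn|y p pth up pn]; first by rewrite -pn in n_pos.
exists x, y; split=> [|t xt]; first by case/andP: pth.
have [txp|txp] := boolP (t \in x :: y :: p); last first.
  suff /nmax : upath n.+1 by rewrite ltnn.
  apply/asboolP; exists t, (x :: y :: p); split; last by rewrite /= -pn.
    by rewrite /= e_sym xt.
  by rewrite cons_uniq txp.
move: txp; rewrite !inE => /or3P [/eqP tx|/eqP //|tp].
  by rewrite tx e_irr in xt.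
case/splitPr: tp pth up {pn} => p1 p2.
have -> : y :: p1 ++ t :: p2 = (y :: rcons p1 t) ++ p2 by rewrite -cat_rcons.
rewrite cat_path -cat_cons cat_uniq => /andP [pth _] /and3P [up _ _].
have /negP[] : ~~ ucycleb e (x :: y :: rcons p1 t).
  by apply: e_acyclic; rewrite /= size_rcons.
rewrite /ucycleb up andbT /cycle rcons_path pth.
by rewrite -rcons_cons last_rcons e_sym.
Qed.

Lemma diam_nat (R : realType) : exists D : nat,
  [/\ diam R e = D%:R, (0 < D)%N &
    forall x y, exists p, walk e x y p /\ (size p <= D)%N].
Proof.
have /choice [len lenP] : forall xy : V * V, exists n : nat,
    gdist e R xy.1 xy.2 = (n%:R)%:E /\
    exists2 p, walk e xy.1 xy.2 p & size p = n.
  move=> [x y] /=; have /connectP [p0 pth lst] := e_conn x y.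
  have [xy_oo|[p wp ->]] := gdist_attained e R x y; last first.
    by exists (size p); split=> //; exists p.
  have : (gdist e R x y <= (size p0)%:R%:E)%E by apply: gdist_walk.
  by rewrite xy_oo leye_eq.
pose D := (\max_(xy : V * V) len xy)%N; exists D.
have lenD xy : (len xy <= D)%N by exact: leq_bigmax.
have [x [y [_ _ xy]]] := card_gt1P V2.
split.
- have [xy0 DE] : {xy0 | D = len xy0}.
    by apply: bigop.eq_bigmax; apply/card_gt0P; exists (x, y).
  rewrite /diam [X in fine X](_ : _ = D%:R%:E) //; apply/eqP; rewrite eq_le.
  apply/andP; split.
    apply: ge_ereal_sup => _ [xy1 _ <-]; have [-> _] := lenP xy1.
    by rewrite lee_fin ler_nat.
  apply: ereal_sup_ubound; exists xy0 => //.
  by have [-> _] := lenP xy0; rewrite DE.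
- apply: leq_trans (lenD (x, y)); have [_ [p [_ lst] <-]] := lenP (x, y).
  by case: p lst => //= xyE; rewrite xyE eqxx in xy.
- move=> x' y'; have [_ [p wp pn]] := lenP (x', y').
  by exists p; split=> //; rewrite pn.
Qed.

End Tree.

(** * The lower bound *)

Section Estimates.
Variables (V : finType) (e : rel V).
Hypotheses (e_sym : symmetric e) (e_irr : irreflexive e).
Hypothesis e_acyclic : forall c : seq V, (2 < size c)%N -> ~~ ucycleb e c.
Hypothesis ext_conn : forall x y, ext_vertex e x -> ext_vertex e y ->
  joined (@ext_adj V e) x y.
Local Notation A := (raag e).
Local Notation gen := (raag_gen e).
Local Notation eadj := (@ext_adj V e).
Local Open Scope group_scope.

(** The link of a leaf generates a cyclic group, so the centralizer of a leaf is
    generated by two commuting elements. *)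
Lemma leaf_centralizer v w g : (forall t, e v t -> t = w) ->
  commute (gen v) g -> syllable_prod g 2.
Proof.
move=> vw /(centralizer_gen e_sym e_irr) [f [z [Lf Zz ->]]].
rewrite -[2%N]/(1 + 1)%N; apply: syllable_prodM; apply: syllable_prod1; last by exists v.
exists w; apply: generated_min Lf; first exact: generated_subgroup.
by move=> _ [t /= /vw -> <-]; exact: generated_sub.
Qed.

(** If [k] and [k'] are conjugators of the first and of the last edge of the
    geodesic from [v] to [v ^ g], then [g = (g * k'^-1) * (k' * k^-1) * k]. The
    outer factors centralize the leaf [v] and have at most two syllables; the
    middle one is controlled by the interior vertices of the geodesic. *)
Lemma syl_le_esum (R : realType) v w g : e v w -> (forall t, e v t -> t = w) ->
  (((syl g)%:R : R)%:E <= 3%:E * (\esum_(x in ext_vertex e)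
     link_dist_set R x (link_proj x (gen v)) (link_proj x (gen v ^ g))) + 4%:E)%E.
Proof.
move=> vw leaf; set S := (\esum_(x in _) _)%E.
have S0 : (0 <= S)%E by apply: esum_ge0 => x _; exact: link_dist_set_ge0.
have vV g' : ext_vertex e (gen v ^ g') by exists v, g'.
have [p0 [pth0 lst0]] := ext_conn (vV 1) (vV g).
rewrite conjg1 in pth0 lst0.
case: (shortenP pth0) lst0 => p pth up _ {p0 pth0}; case: p pth up => [_ _ /=|x q pth up lst].
  move=> vg; have gv : commute (gen v) g.
    by have := conjg_eq_commute (etrans (conjg1 _) vg); rewrite mul1g => /commuteV; rewrite invgK.
  have : ((syl g)%:R%:E <= (4%:R : R)%:E)%E.
    by rewrite lee_fin ler_nat (leq_trans (syl_le (leaf_centralizer leaf gv))).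
  by move=> /le_trans; apply; apply: leeDr; apply: mule_ge0.
have /andP [vx pthq] := pth.
have [a [b [k [ab vE xE]]]] := (ext_adjP e_sym e_irr _ _).1 vx.
have av : a = v by move: vE; rewrite -{1}[gen v]conjg1 => /gen_inj.
rewrite {a}av in ab vE.
have [t [k' [n [gE n_prod n_le]]]] := path_syllables e_sym e_irr e_acyclic ext_conn R
  xE vE ab pthq up lst (fun _ _ => erefl).
have tv := gen_inj gE; rewrite -{t}tv in gE.
have vk : commute (gen v) k.
  have := conjg_eq_commute (etrans (esym vE) (esym (conjg1 _))).
  by rewrite invg1 mulg1.
have gk' := conjg_eq_commute gE.
have g_prod : syllable_prod g (2 + (n + 2)).
  have -> : g = (g * k'^-1) * ((k' * k^-1) * k) by rewrite mulgVK mulgVK.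
  apply: syllable_prodM (leaf_centralizer leaf gk') _.
  exact: syllable_prodM n_prod (leaf_centralizer leaf vk).
apply: (@le_trans _ _ (n%:R%:E + 4%:E)%E).
  rewrite -EFinD lee_fin -natrD ler_nat.
  by apply: leq_trans (syl_le g_prod) _; lia.
apply: leeD => //; apply: le_trans n_le _; apply: lee_pmul => //.
  by apply: sume_ge0 => x' _; exact: link_dist_set_ge0.
apply: sum_uniq_le_esum.
  have : uniq (x :: q) by case/andP: up.
  by rewrite lastI rcons_uniq => /andP [].
move=> x' /mem_belast; clear -pth.
elim: q x {1}(gen v) pth => [|z q IH] x y /=.
  by rewrite andbT => /asboolP [_ xV _ _]; rewrite inE => /eqP ->; exact: xV.
by move=> /andP [/asboolP [_ xV _ _] /IH {}IH]; rewrite inE => /predU1P[->|];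
  [exact: xV|exact: IH].
Qed.

End Estimates.

(** * The comparison *)

Theorem proposition63 (R : realType) (V : finType) (e : rel V)
    (tree_e : is_tree e) (V2 : (1 < #|V|)%N) (g : raag e) :
  exists v : V,
    asymp (4 * diam R e)%R (4 * diam R e)%R
      (\esum_(x in ext_vertex e)
         link_dist_set R x (link_proj x (raag_gen e v))
                           (link_proj x (raag_gen e v ^ g)%g))%E
      ((syl g)%:R%:E)%E.
Proof.
have [e_sym e_irr e_conn e_acyclic] := tree_e.
have [D [-> D_pos D_walk]] := diam_nat e_conn V2 R.
have ext_conn x y := @ext_joined V e e_sym e_irr e_conn D D_pos D_walk V2 x y.
have [v [w [vw leaf]]] := leaf_ex e_sym e_irr e_conn e_acyclic V2.
exists v; set S := (\esum_(x in _) _)%E.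
have lower : ((syl g)%:R%:E <= 3%:E * S + 4%:E)%E.
  exact: (syl_le_esum e_sym e_irr e_acyclic ext_conn _ _ vw leaf).
have upper : (S <= (syl g * (D + D))%:R%:E)%E.
  have [p [pth lst sz]] := gallery_sym e_sym
    (gallery_syllable_prod e_sym e_conn D_pos D_walk V2 v (syllable_prod_syl g)).
  apply: (@le_trans _ _ (size p)%:R%:E); last by rewrite lee_fin ler_nat.
  have := gallery_esum_le e_sym e_irr e_acyclic ext_conn R pth.
  by rewrite lst /pair_vertex /= conjg1.
have S_ge0 : (0 <= S)%E by apply: esum_ge0 => x _; exact: link_dist_set_ge0.
move: S S_ge0 lower upper => [r||] //; rewrite !lee_fin.
(* Both bounds are within the required constants because D >= 1. *)
move=> r_ge0 lower upper; have D1 : (1 <= D%:R :> R) by rewrite ler1n.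
have := ler0n R (syl g); set l : R := (syl g)%:R in lower *.
move: upper lower; rewrite natrM natrD -/l => upper lower l_ge0.
split.
  rewrite -EFinM -EFinB lee_fin lerBlDr ler_pdivrMl; last lra.
  nra.
rewrite -EFinM -EFinD lee_fin; nra.
Qed.
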